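(* Let $v\equiv 1\pmod 4$ with $\gcd(v,45)=1$. If there exists a PS$(v)$, then there exists a maximum $(45v,5,1)$-OOC.
   Context: PS$(v)$ ($v\equiv1\pmod4$): a set $\mathcal S$ of $(v-1)/4$ unordered pairs from $\mathbb{Z}_v$ with $\bigcup_{\{x,y\}\in\mathcal S}\pm\{x,y\}=\mathbb{Z}_v\setminus\{0\}$ and $\bigcup_{\{x,y\}\in\mathcal S}\pm\{x-y,x+y\}=\mathbb{Z}_v\setminus\{0\}$. A $(n,k,1)$-OOC is a set $\mathcal B$ of $k$-subsets of $\mathbb{Z}_n$ such that the multiset $\bigcup_{B\in\mathcal B}[x-y:x,y\in B,x\ne y]$ has no repeated elements; it is maximum if the set of elements of $\mathbb{Z}_n$ not in this multiset has size at most $k(k-1)$. *)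

(* Defs.v *)
From mathcomp Require Import all_boot all_algebra.

Set Implicit Arguments.
Unset Strict Implicit.
Unset Printing Implicit Defensive.

Import GRing.Theory.
Local Open Scope ring_scope.

(* The additive group of integers mod n, for n > 0.  Unlike 'Z_n it is also
   correct (the trivial group) for n = 1; for n = 0 it is a junk value. *)
Notation Zmod n := 'I_n.-1.+1.

Definition pm (G : finZmodType) (A : {set G}) : {set G} :=
  A :|: [set - x | x in A].

(* For P = {x, y} with x != y this is {x - y, y - x, x + y}, so that
   pm (diffsum P) is +-{x - y, x + y}, whichever way P is ordered. *)
Definition diffsum (G : finZmodType) (P : {set G}) : {set G} :=
  [set x - y | x in P, y in P & x != y]
  :|: [set x + y | x in P, y in P & x != y].

Definition is_PS (v : nat) (S : {set {set Zmod v}}) : Prop :=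
  [/\ #|S| = ((v - 1) %/ 4)%N,
      forall P, P \in S -> #|P| = 2%N,
      \bigcup_(P in S) pm P = ~: [set 0]
    & \bigcup_(P in S) pm (diffsum P) = ~: [set 0]].

(* The multiset of differences, as a sequence (with repetitions): one entry
   x - y for each B and each ordered pair of distinct elements x, y of B. *)
Definition differences (G : finZmodType) (B : {set G}) : seq G :=
  [seq p.1 - p.2 | p <- enum (setX B B) & p.1 != p.2].

Definition all_differences (G : finZmodType) (BB : {set {set G}}) : seq G :=
  flatten [seq differences B | B <- enum BB].

(* The parameter lambda is 1. *)
Definition is_OOC (n k : nat) (BB : {set {set Zmod n}}) : Prop :=
  (forall B, B \in BB -> #|B| = k) /\ uniq (all_differences BB).

Definition is_maximum_OOC (n k : nat) (BB : {set {set Zmod n}}) : Prop :=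
  is_OOC k BB /\
  (#|[set z : Zmod n | z \notin all_differences BB]| <= k * (k - 1))%N.

(* Main.v *)
Require Import Defs.
From mathcomp Require Import all_boot all_algebra.
From mathcomp Require Import zify.

(** Identify Z_45v with Z_45 x Z_v.  The blocks {0,3,7,13,30} and
    {0,5,14,26,34} have as differences every element of Z_45 other than
    0, 1, -1, 2, -2, each exactly once.  Spreading such a block {a_0, ..., a_4}
    along every arithmetic progression, as {(a_i, iz) : i}, for all z in Z_v,
    covers every (a, w) with a outside {0, 1, -1, 2, -2}, because 1, 2, 3, 4 are
    invertible modulo v.  The blocks {(0,0), (1,x), (1,-x), (-1,y), (-1,-y)}
    with {x, y} in the PS(v) cover the remaining (a, w) with w nonzero: their
    differences are (+-1, +-x), (+-1, +-y), (0, +-2x), (0, +-2y) and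
    (+-2, +-x+-y).  Counting shows that nothing is covered twice. *)

Set Implicit Arguments.
Unset Strict Implicit.
Unset Printing Implicit Defensive.

Import GRing.Theory.
Local Open Scope ring_scope.

(** * Differences of blocks, and the counting criterion for a maximum OOC *)

Definition covers (G : zmodType) (B : pred G) (z : G) : Prop :=
  exists x y, [/\ B x, B y & x - y = z].

Lemma coversN (G : zmodType) (B : pred G) z : covers B z -> covers B (- z).
Proof. by case=> x [y [Bx By <-]]; exists y, x; rewrite opprB. Qed.

Lemma pmN (G : finZmodType) (A : {set G}) z : (- z \in pm A) = (z \in pm A).
Proof.
suff imp u : u \in pm A -> - u \in pm A.
  by apply/idP/idP => /imp; rewrite ?opprK.
rewrite !inE => /orP[uA|/imsetP[t tA ->]]; last by rewrite opprK tA.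
by apply/orP; right; apply: imset_f.
Qed.

Lemma size_differences (G : finZmodType) (B : {set G}) :
  size (differences B) = (#|B| * (#|B| - 1))%N.
Proof.
rewrite /differences size_map size_filter -sum1_count big_enum_cond /= sum1_card.
have -> : #|[pred p | p \in setX B B & p.1 != p.2]|
        = #|setX B B :\: [set (x, x) | x in B]|.
  apply: eq_card => -[x y]; rewrite !inE /= andbC.
  have [->|nxy] := eqVneq x y.
    by rewrite andbb; case: (boolP (y \in B)) => yB; rewrite ?andbF // imset_f.
  rewrite [_ \in [set _ | _ in _]](introF imsetP) ?andbT // => -[z _ [ex ey]].
  by rewrite ex ey eqxx in nxy.
rewrite cardsD cardsX (setIidPr _) ?card_imset ?mulnBr ?muln1 //.
  by move=> x y [].
by apply/subsetP => _ /imsetP[x xB ->]; rewrite inE /= xB.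
Qed.

Lemma mem_all_differences (G : finZmodType) (BB : {set {set G}}) B x y :
  B \in BB -> x \in B -> y \in B -> x != y -> x - y \in all_differences BB.
Proof.
move=> BBB xB yB nxy; apply/flattenP; exists (differences B).
  by apply: map_f; rewrite mem_enum.
apply/mapP; exists (x, y) => //.
by rewrite mem_filter /= nxy mem_enum inE /= xB yB.
Qed.

(* A sequence of differences that is no longer than the set it covers has no
   repetition. *)
Lemma maximum_OOC_of_cover (n k : nat) (BB : {set {set Zmod n}})
    (D : {set Zmod n}) :
  (forall B, B \in BB -> #|B| = k) ->
  (forall z, z \notin D ->
     exists2 B, B \in BB & exists x y, [/\ x \in B, y \in B, x != y & x - y = z]) ->
  (#|BB| * (k * (k - 1)) + #|D| <= n.-1.+1)%N ->
  (#|D| <= k * (k - 1))%N ->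
  is_maximum_OOC k BB.
Proof.
move=> cardB cover leN leD.
have sub z : z \in ~: D -> z \in all_differences BB.
  rewrite inE => /cover[B BBB [x [y [xB yB nxy <-]]]].
  exact: mem_all_differences BBB xB yB nxy.
have sz : size (all_differences BB) = (#|BB| * (k * (k - 1)))%N.
  rewrite size_flatten sumnE /shape -map_comp big_map big_enum /=.
  rewrite -sum_nat_const; apply: eq_bigr => B /cardB <-.
  exact: size_differences.
split; first split=> //.
  apply: (@leq_size_uniq _ (enum (~: D))); first exact: enum_uniq.
    by move=> z; rewrite mem_enum; apply: sub.
  rewrite sz -cardE -(leq_add2r #|D|).
  by rewrite [(#|~: D| + _)%N]addnC cardsC card_ord.
apply: leq_trans leD; apply/subset_leq_card/subsetP => z.
by rewrite inE; apply: contraNT => nD; apply: sub; rewrite inE.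
Qed.

(** * Division by an integer coprime to v in Z_v *)

Section CoprimeMultiple.
Variables (v m : nat).
Hypotheses (v_gt0 : (0 < v)%N) (co_mv : coprime m v).

Lemma Zmod_mulrn_bezout : exists w, forall z : Zmod v, z *+ (w * m) = z.
Proof.
(* The Chinese remainder of 0 modulo m and 1 modulo v is a multiple of m that acts on Z_v as the
   identity; its quotient by m is an inverse of m modulo v. *)
exists (chinese m v 0 1 %/ m)%N => z.
have -> : (chinese m v 0 1 %/ m * m)%N = chinese m v 0 1.
  by apply: divnK; rewrite /dvdn chinese_modl // mod0n.
rewrite Zp_mulrn; apply: val_inj => /=.
case: z => z /=; rewrite prednK // => ltz.
by rewrite -modnMmr chinese_modr // modnMmr muln1 modn_small.
Qed.

Lemma Zmod_divn (z : Zmod v) : exists z', z' *+ m = z.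
Proof.
by have [w wK] := Zmod_mulrn_bezout; exists (z *+ w); rewrite -mulrnA.
Qed.

Lemma Zmod_mulrn_eq0 (z : Zmod v) : (z *+ m == 0) = (z == 0).
Proof.
apply/eqP/eqP => [zm0|->]; last exact: mul0rn.
have [w wK] := Zmod_mulrn_bezout.
by rewrite -(wK z) mulnC mulrnA zm0 mul0rn.
Qed.

End CoprimeMultiple.

(** * The two base blocks in Z_45 *)

Definition base (c : bool) : seq nat :=
  if c then [:: 0; 3; 7; 13; 30]%N else [:: 0; 5; 14; 26; 34]%N.

(** A finite check over the 45 residues. Ordering the positions as k < i and keeping the sign apart
    makes i - k a positive natural number, by which the second coordinate can later be divided. *)
Lemma base_differences (a : 'I_45) :
  a \notin [:: 0; 1; -1; 2%:R; -2%:R] ->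
  exists c i k, [/\ (k < i < 5)%N &
    let d : 'I_45 := inZp (nth 0%N (base c) i) - inZp (nth 0%N (base c) k) in
    a = d \/ a = - d].
Proof.
(* Adding 45 first keeps the truncated subtraction harmless, as all entries are below 45; the test
   then computes in natural numbers. *)
pose d c i k := (nth 0 (base c) i + (45 - nth 0 (base c) k))%N.
pose test (n : nat) := has (fun c => has (fun i => has (fun k =>
  (d c i k %% 45 == n) || (d c k i %% 45 == n)) (iota 0 i)) (iota 0 5))%N
  [:: true; false].
have dE c i k : (i < 5)%N -> (k < 5)%N ->
    inZp (nth 0%N (base c) i) - inZp (nth 0%N (base c) k)
      = inZp (d c i k) :> 'I_45.
  move=> i5 k5; apply: val_inj.
  by case: c; case: i i5 => [|[|[|[|[|]]]]] // _;
     case: k k5 => [|[|[|[|[|]]]]].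
move=> na.
have /hasP[c _ /hasP[i]] : test a.
  (* Here 44 and 43 represent -1 and -2. *)
  have /allP/(_ a) : all (fun n => (n \in [:: 0; 1; 44; 2; 43]) || test n)%N
                         (iota 0 45) by vm_compute.
  rewrite mem_iota ltn_ord => /(_ isT) /orP[] //.
  by move: na; rewrite -(mem_map val_inj) => /negPf na; rewrite [_ \in _]na.
rewrite mem_iota => /andP[_ i5] /hasP[k]; rewrite mem_iota => /andP[_ ki] e.
exists c, i, k; split; first by rewrite ki.
have k5 := ltn_trans ki i5.
case/orP: e => /eqP e; [left|right]; rewrite ?opprB dE //;
  by apply: val_inj; rewrite /= e.
Qed.

(** * Lines and crosses in Z_45 x Z_v *)

Section Blocks.
Variable v : nat.
Hypotheses (v_gt0 : (0 < v)%N) (co6v : coprime 6 v).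

Local Notation H := ('I_45 * Zmod v)%type.

Definition line (c : bool) (z : Zmod v) : {set H} :=
  [set p in [seq (inZp (nth 0%N (base c) i), z *+ i) | i <- iota 0 5]].

Definition cross (x y : Zmod v) : {set H} :=
  [set p in [:: (0, 0); (1, x); (1, - x); (-1, y); (-1, - y)]].

Let co2v : coprime 2 v.
Proof. exact: coprime_dvdl co6v. Qed.

Let co_small m : (0 < m < 5)%N -> coprime m v.
Proof.
have co3v : coprime 3 v by exact: coprime_dvdl co6v.
case: m => [|[|[|[|[|]]]]] // _; first exact: coprime1n.
by rewrite (coprimeMl v 2 2) co2v.
Qed.

Lemma card_line c z : #|line c z| = 5%N.
Proof.
pose s := [seq (inZp (nth 0%N (base c) i) : 'I_45, z *+ i) | i <- iota 0 5].
have /card_uniqP card_s : uniq s.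
  (* The first coordinates are already distinct, so z = 0 needs no separate treatment. *)
  by apply: (@map_uniq _ _ fst); rewrite -map_comp; case: c @s.
by rewrite cardsE card_s size_map.
Qed.

Lemma card_cross x y : x != 0 -> y != 0 -> #|cross x y| = 5%N.
Proof.
(* Points sharing a first coordinate have opposite second coordinates, which differ because 2 is
   invertible modulo v. *)
have opp_neq (z : Zmod v) : z != 0 -> (z == - z) = false.
  move=> nz; rewrite -subr_eq0 opprK -mulr2n Zmod_mulrn_eq0 //.
  exact: negbTE.
move=> nx ny.
have /card_uniqP card_s :
    uniq [:: (0, 0); (1, x); (1, - x); (-1, y); (-1, - y) : H].
  by rewrite /= !inE !xpair_eqE /= !opp_neq.
by rewrite cardsE card_s.
Qed.

Lemma line_cover (a : 'I_45) (w : Zmod v) :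
  a \notin [:: 0; 1; -1; 2%:R; -2%:R] ->
  exists c z, covers (mem (line c z)) (a, w).
Proof.
case/base_differences => c [i [k [/andP[ki i5] aE]]].
have k5 := ltn_trans ki i5.
have co_ik : coprime (i - k) v.
  by rewrite co_small // subn_gt0 ki (leq_ltn_trans (leq_subr _ _)).
pose pt z j : H := (inZp (nth 0%N (base c) j), z *+ j).
have ptP z j : (j < 5)%N -> pt z j \in line c z.
  by move=> j5; rewrite inE; apply: map_f; rewrite mem_iota.
have ptB z : covers (mem (line c z)) (pt z i - pt z k).
  by exists (pt z i), (pt z k); split=> //; apply: ptP.
(* Points i and k of [line c z] differ by (i - k)z in the second coordinate, so z is w divided by i
   - k. When a is the negated difference, z is obtained from -w instead and the result is
   negated. *)
case: aE => ->.
  have [z <-] := Zmod_divn v_gt0 co_ik w; exists c, z.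
  by rewrite mulrnBr 1?ltnW //; apply: ptB.
have [z zE] := Zmod_divn v_gt0 co_ik (- w); exists c, z.
by rewrite -[w]opprK -zE mulrnBr 1?ltnW //; apply: coversN (ptB z).
Qed.

(** The first clause only yields doubles: distinct points of a cross with equal first coordinates
    have opposite second coordinates. *)
Lemma cross_cover (x y : Zmod v) (B := mem (cross x y)) :
  [/\ forall u, u \in pm [set x; y] -> covers B (0, u *+ 2),
      forall u, u \in pm [set x; y] -> covers B (1, u) /\ covers B (-1, u)
    & forall u, u \in pm (diffsum [set x; y]) ->
        covers B (2%:R, u) /\ covers B (-2%:R, u)].
Proof.
pose pts : seq H := [:: (0, 0); (1, x); (1, - x); (-1, y); (-1, - y)].
have covB i j r : (i < 5)%N -> (j < 5)%N ->
    nth 0 pts i - nth 0 pts j = r -> covers B r.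
  have ptsP k : (k < 5)%N -> nth 0 pts k \in cross x y.
    by move=> k5; rewrite in_set mem_nth.
  move=> i5 j5 <-; exists (nth 0 pts i), (nth 0 pts j).
  by split=> //; apply: ptsP.
have pmE u : u \in pm [set x; y] -> u \in [:: x; - x; y; - y].
  rewrite !inE => /orP[/orP[]/eqP->|/imsetP[t]]; rewrite ?eqxx ?orbT //.
  by rewrite !inE => /orP[]/eqP-> ->; rewrite eqxx ?orbT.
have pm_diffsumE u : u \in pm (diffsum [set x; y]) ->
    u \in [:: x - y; y - x; x + y; - (x + y)].
  have dE t : t \in diffsum [set x; y] -> t \in [:: x - y; y - x; x + y].
    rewrite inE => /orP[] /imset2P[p q]; rewrite !inE => pP /andP[qP npq] ->;
      case/orP: pP npq => /eqP-> {p}; case/orP: qP => /eqP->;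
      by rewrite ?eqxx ?orbT // [y + x]addrC eqxx ?orbT.
  rewrite inE => /orP[/dE|/imsetP[t /dE + ->]]; rewrite !inE.
    by case/or3P=> ->; rewrite ?orbT.
  by case/or3P=> /eqP->; rewrite ?opprB eqxx ?orbT.
(* Only first coordinates 1 and 2 are checked by cases; -1 and -2 follow by negation, under which
   [pm] is closed. *)
have cov1 u : u \in pm [set x; y] -> covers B (1, u).
  move/pmE; rewrite !inE => /or4P[]/eqP->.
  - by apply: (covB 1%N 0%N) => //=; congr pair; rewrite /= subr0.
  - by apply: (covB 2%N 0%N) => //=; congr pair; rewrite /= subr0.
  - by apply: (covB 0%N 4%N) => //=; congr pair; rewrite /= sub0r opprK.
  - by apply: (covB 0%N 3%N) => //=; congr pair; rewrite /= sub0r ?opprK.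
have cov2 u : u \in pm (diffsum [set x; y]) -> covers B (2%:R, u).
  move/pm_diffsumE; rewrite !inE => /or4P[]/eqP->.
  - by apply: (covB 1%N 3%N) => //=; congr pair; rewrite /= opprK.
  - by apply: (covB 2%N 4%N) => //=; congr pair; rewrite /= opprK // addrC.
  - by apply: (covB 1%N 4%N) => //=; congr pair; rewrite /= opprK.
  - by apply: (covB 2%N 3%N) => //=; congr pair; rewrite /= ?opprK ?opprD.
split=> u uP.
- move: (pmE _ uP); rewrite !inE => /or4P[]/eqP->.
  + by apply: (covB 1%N 2%N) => //=; congr pair; rewrite /= ?subrr ?opprK.
  + by apply: (covB 2%N 1%N) => //=; congr pair; rewrite /= ?subrr.
  + by apply: (covB 3%N 4%N) => //=; congr pair; rewrite /= ?subrr ?opprK.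
  + by apply: (covB 4%N 3%N) => //=; congr pair; rewrite /= ?subrr.
- split; first exact: cov1.
  by rewrite -[u]opprK; apply: coversN (cov1 _ _); rewrite pmN.
- split; first exact: cov2.
  by rewrite -[u]opprK; apply: coversN (cov2 _ _); rewrite pmN.
Qed.

End Blocks.

(** * The Chinese remainder isomorphism *)

Lemma inZp_dvdD (d n : nat) : (0 < d)%N -> (0 < n)%N -> (d %| n)%N ->
  {morph (fun g : Zmod n => inZp g : Zmod d) : g h / g + h}.
Proof.
case: d n => [|d] [|n] // _ _ dn g h; apply: val_inj.
by rewrite /= modnDm modn_dvdm.
Qed.

(** Reduction modulo both factors is injective between sets of equal size. Compatibility with
    subtraction is all that pulling back differences requires. *)
Lemma chinese_bij (m n : nat) : (0 < m)%N -> (0 < n)%N -> coprime m n ->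
  exists psi : Zmod (m * n) -> Zmod m * Zmod n,
    bijective psi /\ {morph psi : g h / g - h}.
Proof.
move=> m0 n0 co_mn; have mn0 : (0 < m * n)%N by rewrite muln_gt0 m0.
pose psi (g : Zmod (m * n)) : Zmod m * Zmod n := (inZp g, inZp g).
have psiD : {morph psi : g h / g + h}.
  move=> g h; congr pair; first exact: inZp_dvdD m0 mn0 (dvdn_mulr _ _) g h.
  exact: inZp_dvdD n0 mn0 (dvdn_mull _ _) g h.
exists psi; split; last first.
  by move=> g h; apply: (addIr (psi h)); rewrite -psiD !subrK.
apply: inj_card_bij; last by rewrite card_prod !card_ord !prednK.
move=> g h [eq_m eq_n]; apply: val_inj; move: eq_m eq_n => /=.
have lt_ord (x : Zmod (m * n)) : (x < m * n)%N by case: x => x /=; rewrite prednK.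
move: (nat_of_ord g) (lt_ord g) (nat_of_ord h) (lt_ord h) => a lt_a b lt_b.
rewrite !prednK // => eq_m eq_n; apply/eqP.
rewrite -(modn_small lt_a) -(modn_small lt_b) chinese_remainder //.
by rewrite eq_m eq_n !eqxx.
Qed.

(** Orders an unordered pair of the PS, so that [cross] can be applied to it. *)
Lemma set2_enum (T : finType) (x0 : T) (P : {set T}) : #|P| = 2%N ->
  P = [set nth x0 (enum P) 0; nth x0 (enum P) 1].
Proof.
rewrite cardE; case eP: (enum P) => [|x [|y []]] //= _.
by apply/setP => z; rewrite -mem_enum eP !inE.
Qed.

(** * Assembling the family of blocks *)

Theorem theorem6p2 (v : nat) (hv : v = 1 %[mod 4]) (hgcd : gcdn v 45 = 1%N)
    (hPS : exists S : {set {set Zmod v}}, is_PS S) :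
  exists BB : {set {set Zmod (45 * v)}}, is_maximum_OOC 5 BB.
Proof.
have [S [cardS cardP covS covDS]] := hPS.
have v_eq : v = (((v - 1) %/ 4) * 4).+1.
  by rewrite {1 2}(divn_eq v 4) hv addnK mulnK // addn1.
have v_gt0 : (0 < v)%N by rewrite v_eq.
have co45 : coprime 45 v by rewrite coprime_sym; apply/eqP.
have co6 : coprime 6 v.
  have co3 : coprime 3 v by exact: coprime_dvdl co45.
  by rewrite (coprimeMl v 2 3) co3 coprime2n v_eq /= oddM andbF.
have co2 : coprime 2 v by exact: coprime_dvdl co6.
have [psi [psi_bij psiB]] := chinese_bij (isT : 0 < 45)%N v_gt0 co45.
pose X (P : {set Zmod v}) := cross (nth 0 (enum P) 0) (nth 0 (enum P) 1).
pose BB := [set psi @^-1: line c.1 c.2 | c : bool * Zmod v]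
       :|: [set psi @^-1: X P | P in S].
pose A : seq 'I_45 := [:: 0; 1; -1; 2%:R; -2%:R].
(* The at most five elements that the blocks are not asked to cover. *)
pose D := psi @^-1: [set (a, 0) | a in A].
have card_pre (B : {set Zmod 45 * Zmod v}) : #|psi @^-1: B| = #|B|.
  by apply: on_card_preimset; apply: onW_bij.
have cardD : (#|D| <= 5)%N.
  by rewrite card_pre (leq_trans (leq_imset_card _ _)) // card_size.
exists BB; apply: (@maximum_OOC_of_cover _ _ _ D).
- move=> B; rewrite inE => /orP[/imsetP[c _ ->]|/imsetP[P PS ->]].
    by rewrite card_pre card_line.
  (* The sets [pm P] have union the nonzero elements, so no pair contains 0. *)
  have nz u : u \in P -> u != 0.
    move=> uP; have : u \in ~: [set 0].
      by rewrite -covS; apply/bigcupP; exists P; rewrite // inE uP.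
    by rewrite !inE.
  by rewrite card_pre card_cross // nz // -mem_enum mem_nth // -cardE cardP.
- move=> z zD; case psi_z: (psi z) => [a w].
  suff: exists2 B : {set Zmod 45 * Zmod v},
      psi @^-1: B \in BB & covers (mem B) (psi z).
    case=> B BBB [p [q [pB qB pq]]]; have [phi psiK phiK] := psi_bij.
    exists (psi @^-1: B) => //; exists (phi p), (phi q).
    have pqz : phi p - phi q = z by apply: (can_inj psiK); rewrite psiB !phiK.
    split; rewrite ?inE ?phiK //.
    (* Since [covers] allows equal points, distinctness is recovered here: equal points would give
       [psi z] = 0, which puts z in [D]. *)
    apply: contraNneq zD => e; rewrite inE -pq -[p]phiK -[q]phiK e subrr.
    by apply/imsetP; exists 0; rewrite ?inE ?eqxx.
  rewrite psi_z; case: (boolP (a \in A)) => aA; last first.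
    have [c [t cov]] := line_cover v_gt0 co6 w aA.
    exists (line c t) => //; rewrite inE; apply/orP; left.
    by apply/imsetP; exists (c, t).
  have nw : w != 0.
    apply: contraNneq zD => w0; rewrite inE psi_z w0.
    by apply/imsetP; exists a.
  have inX P : P \in S -> psi @^-1: X P \in BB.
    by move=> PS; rewrite inE; apply/orP; right; apply/imsetP; exists P.
  have crossP P : P \in S ->
      [/\ forall t, t \in pm P -> covers (mem (X P)) (0, t *+ 2),
          forall t, t \in pm P ->
            covers (mem (X P)) (1, t) /\ covers (mem (X P)) (-1, t)
        & forall t, t \in pm (diffsum P) ->
            covers (mem (X P)) (2%:R, t) /\ covers (mem (X P)) (-2%:R, t)].
    move=> PS; have := cross_cover (nth 0 (enum P) 0) (nth 0 (enum P) 1).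
    by rewrite -(set2_enum 0 (cardP P PS)).
  have inS u : u != 0 -> exists2 P, P \in S & u \in pm P.
    move=> nu; have : u \in ~: [set 0] by rewrite !inE.
    by rewrite -covS => /bigcupP.
  have inDS u : u != 0 -> exists2 P, P \in S & u \in pm (diffsum P).
    move=> nu; have : u \in ~: [set 0] by rewrite !inE.
    by rewrite -covDS => /bigcupP.
  (* First coordinate 0 uses the first PS condition at w/2, coordinates 1 and -1 use it at w, and
     coordinates 2 and -2 use the second condition at w. *)
  have [u uw] := Zmod_divn v_gt0 co2 w.
  have nu : u != 0 by rewrite -(Zmod_mulrn_eq0 v_gt0 co2) uw.
  have [P0 P0S uP] := inS u nu.
  have [P1 P1S wP] := inS w nw.
  have [P2 P2S wD] := inDS w nw.
  have [/(_ _ uP) cov0 _ _] := crossP _ P0S.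
  have [_ /(_ _ wP)[cov1 cov1'] _] := crossP _ P1S.
  have [_ _ /(_ _ wD)[cov2 cov2']] := crossP _ P2S.
  move: aA; rewrite !inE => /orP[|/orP[|/or3P[]]] /eqP->.
  + by exists (X P0); [apply: inX | rewrite -uw].
  + by exists (X P1); [apply: inX |].
  + by exists (X P1); [apply: inX |].
  + by exists (X P2); [apply: inX |].
  + by exists (X P2); [apply: inX |].
- have cardBB : (#|BB| <= 2 * v + (v - 1) %/ 4)%N.
    apply: leq_trans (leq_card_setU _ _) _; rewrite -cardS leq_add ?leq_imset_card //.
    apply: leq_trans (leq_imset_card _ _) _.
    by rewrite card_prod card_bool card_ord prednK.
  (* The count is tight: 20(2v + (v - 1)/4) + 5 = 45v. *)
  apply: (leq_trans (leq_add (leq_mul cardBB (leqnn _)) cardD)).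
  by move: v_eq; lia.
- exact: leq_trans cardD _.
Qed.
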